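(* Let $\mathcal{G}$ and $\mathcal{H}$ be finite simple hypergraphs such that $V(\mathcal{H})=V(\mathcal{G})\cup\{w_1,\ldots,w_t\}$ with $w_i\notin V(\mathcal{G})$ for all $i$, and $E(\mathcal{H})=E(\mathcal{G})\cup\{\{v,w_1,\ldots,w_t\}\}$ for some vertex $v\in V(\mathcal{G})$. Let $R=K[x_\alpha:\alpha\in V(\mathcal{G})]$ and $R'=K[x_\alpha:\alpha\in V(\mathcal{H})]$. Then for all $s\geq1$, $$\mathrm{Ass}_{R'}(R'/J(\mathcal{H})^s)=\mathrm{Ass}_R(R/J(\mathcal{G})^s)\cup\{(x_v,x_{w_1},\ldots,x_{w_t})\},$$ where monomial primes of $R$ are regarded as monomial primes of $R'$ (generated by the same variables).
   Context: A hypergraph $\mathcal{H}$ on a finite vertex set is a collection of subsets (edges); it is simple if no edge contains another. A vertex cover of $\mathcal H$ is a set of vertices meeting every edge; it is minimal if no proper subset is a vertex cover. The cover ideal is $J(\mathcal{H})=(\prod_{i\in W}x_i : W \text{ a minimal vertex cover of } \mathcal{H})$. $\mathrm{Ass}$ denotes the set of associated primes. *)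

(* Defs.v *)
From HB Require Import structures.
From mathcomp Require Import all_boot all_order all_algebra.
From mathcomp Require Import mpoly.
Set Implicit Arguments. Unset Strict Implicit. Unset Printing Implicit Defensive.
Import GRing.Theory.
Local Open Scope ring_scope.

Section Ideals.
Variable R : comNzRingType.

Definition gen_ideal (S : R -> Prop) : R -> Prop :=
  fun f => exists (gs : seq R) (cs : seq R),
    (forall g, g \in gs -> S g) /\ size cs = size gs /\
    f = \sum_(i < size gs) cs`_i * gs`_i.

Definition ideal_pow (I : R -> Prop) (s : nat) : R -> Prop :=
  gen_ideal (fun f => exists gs : seq R,
     size gs = s /\ (forall g, g \in gs -> I g) /\ f = \prod_(g <- gs) g).

Definition is_ideal (I : R -> Prop) : Prop :=
  I 0 /\ (forall x y, I x -> I y -> I (x + y)) /\ (forall a x, I x -> I (a * x)).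

Definition is_prime_ideal (P : R -> Prop) : Prop :=
  is_ideal P /\ ~ P 1 /\ (forall a b, P (a * b) -> P a \/ P b).

Definition Ass (I : R -> Prop) (P : R -> Prop) : Prop :=
  is_prime_ideal P /\ exists f : R, forall g, P g <-> I (g * f).
End Ideals.

Section Hypergraphs.
Variable n : nat.

Definition simple_hypergraph (E : {set {set 'I_n}}) : Prop :=
  forall e f, e \in E -> f \in E -> e \subset f -> e = f.

Definition vertex_cover (E : {set {set 'I_n}}) (W : {set 'I_n}) : bool :=
  [forall e in E, W :&: e != set0].

Definition minimal_vertex_cover (E : {set {set 'I_n}}) (W : {set 'I_n}) : Prop :=
  vertex_cover E W /\ (forall W' : {set 'I_n}, W' \proper W -> ~~ vertex_cover E W').

Variable K : fieldType.

Definition cover_ideal (E : {set {set 'I_n}}) : {mpoly K[n]} -> Prop :=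
  gen_ideal (fun f => exists W, minimal_vertex_cover E W /\
                               f = \prod_(i in W) 'X_i).
End Hypergraphs.

Definition embed_poly (K : fieldType) (n t : nat) (p : {mpoly K[n]}) : {mpoly K[n + t]} :=
  p \mPo [tuple 'X_(lshift t i) | i < n].

Definition extend_ideal (K : fieldType) (n t : nat) (Q : {mpoly K[n]} -> Prop)
  : {mpoly K[n + t]} -> Prop :=
  gen_ideal (fun f => exists g, Q g /\ f = embed_poly t g).

(* edge set of H: edges of G (viewed in 'I_(n+t)) plus {v, w_1, ..., w_t},
   where w_i is the vertex n + i *)
Definition added_edge (n t : nat) (v : 'I_n) : {set 'I_(n + t)} :=
  lshift t v |: [set rshift n i | i : 'I_t].

Definition extend_edges (n t : nat) (E : {set {set 'I_n}}) : {set {set 'I_(n + t)}} :=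
  [set [set lshift t x | x in e] | e : {set 'I_n} in E].

(* Main.v *)
(** Everything reduces to exponent vectors. A monomial ideal is given by an upward closed set U
    of exponents, and its associated primes are exactly the colon ideals (I : x^m) by monomials
    for which {u | u + m in U} is a prime upper set. The power J(E)^s corresponds to
    the exponents dominating a sum of s indicators of vertex covers of E. With
    p = (x_v, x_w1, ..., x_wt), the key identity is J(H)^s = J(G)^s R' /\ p^s: each of s covers
    of G missing v can be completed by its own variable of p as soon as the total degree in the
    variables of p is at least s. A prime colon ideal of the intersection is then p when
    x^m lies in J(G)^s R', and extended from R otherwise, since x_w1^s * x^m lies in p^s. *)
Require Import Defs.
From Stdlib Require Import Classical.
From HB Require Import structures.
From mathcomp Require Import all_boot all_order all_algebra.
From mathcomp Require Import mpoly ring.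
Set Implicit Arguments. Unset Strict Implicit. Unset Printing Implicit Defensive.
Import GRing.Theory.
Local Open Scope ring_scope.

(** * Ideals given by generators *)

Lemma gen_ideal_mem (R : comNzRingType) (S : R -> Prop) f : S f -> gen_ideal S f.
Proof.
move=> Sf; exists [:: f], [:: 1]; split; last split=> //=.
  by move=> g; rewrite inE => /eqP ->.
by rewrite big_ord1 mul1r.
Qed.

Lemma gen_ideal_ideal (R : comNzRingType) (S : R -> Prop) : is_ideal (gen_ideal S).
Proof.
split; last split.
- by exists [::], [::]; rewrite big_ord0.
- move=> x y [gs [cs [hg [sz ->]]]] [gs' [cs' [hg' [sz' ->]]]].
  exists (gs ++ gs'), (cs ++ cs'); split; last split.
  + by move=> g; rewrite mem_cat => /orP [/hg|/hg'].
  + by rewrite !size_cat sz sz'.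
  rewrite size_cat big_split_ord /=; congr (_ + _); apply: eq_bigr => i _.
    by rewrite !nth_cat sz ltn_ord.
  by rewrite !nth_cat sz ltnNge leq_addr /= addKn.
move=> a x [gs [cs [hg [sz ->]]]].
exists gs, [seq a * c | c <- cs]; split=> //; split; first by rewrite size_map.
rewrite mulr_sumr; apply: eq_bigr => i _.
by rewrite (nth_map 0) ?sz // mulrA.
Qed.

Lemma gen_ideal_mul (R : comNzRingType) (S : R -> Prop) a f : S f -> gen_ideal S (a * f).
Proof. by case: (gen_ideal_ideal S) => _ [_ h] Sf; apply/h/gen_ideal_mem. Qed.

Lemma is_ideal_opp (R : comNzRingType) (I : R -> Prop) x : is_ideal I -> I x -> I (- x).
Proof. by case=> _ [_ h] /(h (-1)); rewrite mulN1r. Qed.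

Lemma is_ideal_sum (R : comNzRingType) (I : R -> Prop) (T : eqType) (r : seq T)
    (F : T -> R) :
  is_ideal I -> (forall i, i \in r -> I (F i)) -> I (\sum_(i <- r) F i).
Proof.
case=> I0 [ID _] IF; rewrite big_seq.
by elim/big_ind: _ => // i /IF.
Qed.

Lemma gen_ideal_min (R : comNzRingType) (S I : R -> Prop) :
  is_ideal I -> (forall f, S f -> I f) -> forall f, gen_ideal S f -> I f.
Proof.
move=> idI SI _ [gs [cs [hg [_ ->]]]]; apply: is_ideal_sum => // i _.
by case: idI => _ [_]; apply; apply/SI/hg/mem_nth.
Qed.

(** * Monomial ideals as upper sets of exponents, and their associated primes *)

Section MonomialIdeals.
Variables (K : fieldType) (n : nat).
Implicit Types (U V : 'X_{1..n} -> Prop) (f g : {mpoly K[n]}).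

Definition monomial_ideal U f : Prop := forall m, m \in msupp f -> U m.

Definition upper U : Prop := forall a b, U a -> U (a + b)%MM.

(** The exponents of the monomials in a monomial prime: the complement is a submonoid closed under
    taking divisors. *)
Definition prime_upper V : Prop :=
  upper V /\ ~ V 0%MM /\ (forall a b, V (a + b)%MM -> V a \/ V b).

Lemma monomial_ideal_ideal U : upper U -> is_ideal (monomial_ideal U).
Proof.
move=> upU; split; last split.
- by move=> m; rewrite msupp0.
- by move=> f g If Ig m /msuppD_le; rewrite mem_cat => /orP [/If|/Ig].
move=> a f If m /msuppM_le /allpairsP [[m1 m2] [_ /If h ->]] /=.
by rewrite addmC; apply: upU.
Qed.

Lemma monomial_idealX U m : monomial_ideal U 'X_[m] <-> U m.
Proof.
split=> [|Um m']; first by apply; rewrite msuppX inE.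
by rewrite msuppX inE => /eqP ->.
Qed.

(** Multiplication by a monomial translates the support without cancellation, so colons by monomials
    become translates of [U]. *)
Lemma monomial_idealMX U f m :
  monomial_ideal U (f * 'X_[m]) <-> monomial_ideal (fun u => U (u + m)%MM) f.
Proof.
split=> h u.
  by move=> uf; apply: h; rewrite (perm_mem (msuppMX _ _)) addmC map_f.
by rewrite (perm_mem (msuppMX _ _)) => /mapP [m' /h + ->]; rewrite addmC.
Qed.

Lemma ideal_monomials (I : {mpoly K[n]} -> Prop) f :
  is_ideal I -> (forall m, m \in msupp f -> I 'X_[m]) -> I f.
Proof.
move=> idI If; rewrite (mpolyE f); apply: is_ideal_sum => // m /If.
by rewrite -mul_mpolyC; case: idI => _ [_]; apply.
Qed.

Lemma gen_ideal_monomial U (S : {mpoly K[n]} -> Prop) : upper U ->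
  (forall f, S f -> monomial_ideal U f) ->
  (forall m, U m -> gen_ideal S 'X_[m]) ->
  forall f, gen_ideal S f <-> monomial_ideal U f.
Proof.
move=> upU SU US f; split.
  by apply: gen_ideal_min => //; apply: monomial_ideal_ideal.
by move=> h; apply: (ideal_monomials (gen_ideal_ideal S)) => m /h /US.
Qed.

Lemma size_msupp_rem f m : m \in msupp f ->
  (size (msupp (f - f@_m *: 'X_[m])) < size (msupp f))%N.
Proof.
move=> mf; rewrite (perm_size (msupp_rem _ _)) size_rem //.
by case: (msupp f) mf.
Qed.

Lemma ideal_term (I : {mpoly K[n]} -> Prop) c m : is_ideal I -> I 'X_[m] -> I (c *: 'X_[m]).
Proof. by case=> _ [_ h] /(h c%:MP); rewrite mul_mpolyC. Qed.

Lemma msupp_lead_mul f g : f != 0 -> g != 0 -> (mlead f + mlead g)%MM \in msupp (f * g).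
Proof. by move=> f0 g0; rewrite -mleadM // mlead_supp // mulf_neq0. Qed.

(** Leading exponents add, so that of [a] or that of [b] lies in [V]. Subtracting this leading term
    keeps the product in the ideal, and the induction runs on the total number of terms. *)
Lemma prime_monomial_ideal V : prime_upper V -> is_prime_ideal (monomial_ideal V).
Proof.
case=> upV [V0 prV]; have idV := monomial_ideal_ideal upV.
have [I0 [ID IM]] := idV.
split=> //; split.
  by move=> h; apply: V0; apply: h; rewrite msupp1 inE.
move=> a b; have [k] := ubnP (size (msupp a) + size (msupp b))%N.
elim: k a b => // k IH a b szk hab.
have [->|a0] := eqVneq a 0; first by left.
have [->|b0] := eqVneq b 0; first by right.
have := prV _ _ (hab _ (msupp_lead_mul a0 b0)).
have red (c d : {mpoly K[n]}) : monomial_ideal V (c * d) -> V (mlead c) ->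
    monomial_ideal V ((c - c@_(mlead c) *: 'X_[mlead c]) * d).
  move=> hcd Vc; rewrite mulrBl; apply: ID => //.
  apply: (is_ideal_opp idV); rewrite mulrC; apply: IM.
  by apply: (ideal_term _ idV); apply/monomial_idealX.
have lift (c : {mpoly K[n]}) : V (mlead c) ->
    monomial_ideal V (c - c@_(mlead c) *: 'X_[mlead c]) -> monomial_ideal V c.
  move=> Vc hc; rewrite -[c](subrK (c@_(mlead c) *: 'X_[mlead c])).
  by apply: ID => //; apply: (ideal_term _ idV); apply/monomial_idealX.
case=> Vl.
- have [|h|h] := IH _ _ _ (red _ _ hab Vl); last by right.
    by rewrite -ltnS; apply: leq_trans szk; rewrite ltnS ltn_add2r size_msupp_rem ?mlead_supp.
  by left; apply: lift.
rewrite mulrC in hab.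
have [|h|h] := IH _ _ _ (red _ _ hab Vl); last by left.
  by rewrite addnC -ltnS; apply: leq_trans szk; rewrite ltnS ltn_add2l size_msupp_rem ?mlead_supp.
by right; apply: lift.
Qed.

(* Killing a term of [f] whose colon ideal is larger than [P] does not change [(I : f)];
   once no such term is left, comparing leading terms shows that [P] is the colon ideal of
   the leading monomial of [f]. *)
Lemma prime_colon_monomial U (P : {mpoly K[n]} -> Prop) f : upper U -> is_prime_ideal P ->
  (forall g, P g <-> monomial_ideal U (g * f)) ->
  exists m, forall g, P g <-> monomial_ideal (fun u => U (u + m)%MM) g.
Proof.
move=> upU [idP [P1 prP]]; have idU := monomial_ideal_ideal upU.
have [k] := ubnP (size (msupp f)).
elim: k f => // k IH f szk hf.
have [[m [u [mf [Uum nPu]]]]|noterm] := classic (exists m u,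
    m \in msupp f /\ U (u + m)%MM /\ ~ P 'X_[u]).
  apply: (IH ((f - f@_m *: 'X_[m]) * 'X_[u])).
    rewrite (perm_size (msuppMX _ _)) size_map.
    by apply: leq_trans (size_msupp_rem mf) _.
  move=> g; have -> : g * ((f - f@_m *: 'X_[m]) * 'X_[u]) =
      (g * 'X_[u]) * f - g * (f@_m)%:MP * 'X_[(u + m)%MM].
    rewrite mpolyXD -mul_mpolyC.
    by move: (f@_m)%:MP 'X_[u] 'X_[m] => c x y; ring.
  have tU : monomial_ideal U (g * (f@_m)%:MP * 'X_[(u + m)%MM]).
    by case: idU => _ [_]; apply; apply/monomial_idealX.
  have -> : P g <-> P (g * 'X_[u]).
    split=> [|/prP [//|//]].
    by rewrite mulrC; case: idP => _ [_]; apply.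
  rewrite hf; case: (idU) => _ [UD _]; split=> h.
    by apply: UD => //; apply: (is_ideal_opp idU).
  by rewrite -[_ * f](subrK (g * (f@_m)%:MP * 'X_[(u + m)%MM])); apply: UD.
have f0 : f != 0.
  apply/eqP => f0; apply/P1/hf; rewrite f0 mulr0.
  by case: idU.
exists (mlead f) => g; split; last first.
  move=> h; apply: (ideal_monomials idP) => u /h Uu; apply: NNPP => nP.
  by apply: noterm; exists (mlead f), u; split=> //; apply: mlead_supp.
(* [P g] puts the leading exponent of [g * f] in [U], so by [noterm] the leading monomial of [g]
   lies in [P]; its term is subtracted and the induction is on the number of terms. *)
have [l] := ubnP (size (msupp g)).
elim: l g => // l IHl g szl Pg u.
have [->|g0] := eqVneq g 0; first by rewrite msupp0.
have Ul : U (mlead g + mlead f)%MM.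
  by have := (hf g).1 Pg; apply; apply: msupp_lead_mul.
have Pl : P 'X_[mlead g].
  apply: NNPP => nP; apply: noterm; exists (mlead f), (mlead g).
  by split=> //; apply: mlead_supp.
have [->//|un] := eqVneq u (mlead g).
move=> ug; apply: (IHl (g - g@_(mlead g) *: 'X_[mlead g])).
- by apply: leq_trans (size_msupp_rem _) _ => //; apply: mlead_supp.
- case: (idP) => _ [PD _]; apply: PD => //.
  by apply: (is_ideal_opp idP); apply: (ideal_term _ idP).
by rewrite (perm_mem (msupp_rem _ _)) rem_filter ?msupp_uniq // mem_filter /= un.
Qed.

Lemma Ass_ext (I I' : {mpoly K[n]} -> Prop) P : (forall f, I f <-> I' f) -> Ass I P <-> Ass I' P.
Proof.
by move=> h; split=> -[prP [f hf]]; split=> //; exists f => g; rewrite hf h.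
Qed.

(** A prime colon ideal is already a colon by a monomial ([prime_colon_monomial]), and its primality
    can be tested on monomials. *)
Lemma Ass_monomial_ideal U (P : {mpoly K[n]} -> Prop) : upper U ->
  Ass (monomial_ideal U) P <->
  exists m, prime_upper (fun u => U (u + m)%MM) /\
            forall g, P g <-> monomial_ideal (fun u => U (u + m)%MM) g.
Proof.
move=> upU; split=> [[prP [f hf]]|[m [prm hP]]]; last first.
  have [[I0 [ID IM]] [I1 Ipr]] := prime_monomial_ideal prm.
  split; last by exists 'X_[m] => g; rewrite hP monomial_idealMX.
  split; first split; last split.
  - by apply/hP.
  - split=> [x y /hP hx /hP hy|]; first by apply/hP/ID.
    by move=> a x /hP hx; apply/hP/IM.
  - by move/hP.
  by move=> a b /hP /Ipr [] h; [left|right]; apply/hP.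
have [m hm] := prime_colon_monomial upU prP hf.
exists m; split=> //; case: prP => _ [P1 prP]; split; last split.
- by move=> a b h; rewrite -addmA [(b + m)%MM]addmC addmA; apply: upU.
- by move=> h; apply/P1/hm => u; rewrite msupp1 inE => /eqP ->.
move=> a b h; have /prP : P ('X_[a] * 'X_[b]).
  by rewrite -mpolyXD; apply/hm/monomial_idealX.
by case=> /hm /monomial_idealX; [left|right].
Qed.

End MonomialIdeals.

(** * Powers of cover ideals in terms of exponents *)

Section Covers.
Variable n : nat.
Implicit Types (E : {set {set 'I_n}}) (W : {set 'I_n}) (Ws : seq {set 'I_n}).

Definition set_mnm W : 'X_{1..n} := [multinom nat_of_bool (i \in W) | i < n].

(** Arbitrary covers are allowed: each contains a minimal one, whose indicator is smaller, so
    minimal covers give the same exponents. *)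
Definition covered E s (m : 'X_{1..n}) : Prop := exists Ws : seq {set 'I_n},
  size Ws = s /\ all (vertex_cover E) Ws /\
  forall i, (count (fun W : {set 'I_n} => i \in W) Ws <= m i)%N.

Lemma upper_covered E s : upper (covered E s).
Proof.
move=> a b [Ws [sz [cv le]]]; exists Ws; split=> //; split=> // i.
by rewrite mnmDE (leq_trans (le i)) ?leq_addr.
Qed.

Lemma covered_cons E s W m :
  vertex_cover E W -> covered E s m -> covered E s.+1 (set_mnm W + m)%MM.
Proof.
move=> cW [Ws [sz [cv le]]]; exists (W :: Ws); split; first by rewrite /= sz.
by split=> [|i] /=; rewrite ?cW // mnmDE mnmE leq_add2l.
Qed.

Lemma coveredD E s s' m m' :
  covered E s m -> covered E s' m' -> covered E (s + s') (m + m')%MM.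
Proof.
move=> [Ws [sz [cv le]]] [Ws' [sz' [cv' le']]]; exists (Ws ++ Ws').
rewrite size_cat sz sz' all_cat cv cv'; split=> //; split=> // i.
by rewrite count_cat mnmDE leq_add.
Qed.

Lemma vertex_coverP E W :
  reflect (forall e, e \in E -> exists2 x, x \in W & x \in e) (vertex_cover E W).
Proof.
apply: (iffP forall_inP) => h e /h.
  by case/set0Pn => x /setIP [xW xe]; exists x.
by case=> x xW xe; apply/set0Pn; exists x; rewrite inE xW.
Qed.

Lemma minimal_subcover E W : vertex_cover E W ->
  exists2 W', minimal_vertex_cover E W' & W' \subset W.
Proof.
move=> cW; have [W' /minsetP [cW' minW'] sub] := @minset_exists _ (vertex_cover E) _ cW.
exists W' => //; split=> // W'' prop; apply/negP => cW''.
by have := prop; rewrite (minW' _ cW'' (proper_sub prop)) properxx.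
Qed.

Variable K : fieldType.

Lemma prod_set_mnm W : \prod_(i in W) 'X_i = 'X_[set_mnm W] :> {mpoly K[n]}.
Proof.
rewrite mpolyXE_id big_mkcond; apply: eq_bigr => i _.
by rewrite mnmE; case: (i \in W).
Qed.

Lemma cover_ideal_covered E f :
  cover_ideal E f <-> monomial_ideal (K := K) (covered E 1) f.
Proof.
apply: gen_ideal_monomial; first exact: upper_covered.
  move=> _ [W [[cW _] ->]]; rewrite prod_set_mnm; apply/monomial_idealX.
  exists [:: W]; split=> //; split; first by rewrite /= cW.
  by move=> i; rewrite mnmE /= addn0.
move=> m [[|W [|? ?]] [] // _ [/andP [/minimal_subcover [W' mW' sub] _] le]].
have le' : (set_mnm W' <= m)%MM.
  apply/mnm_lepP => i; apply: leq_trans (le i); rewrite mnmE /= addn0.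
  by case: (boolP (i \in W')) => // /(subsetP sub) ->.
rewrite -(submK le') mpolyXD; by apply: gen_ideal_mul; exists W'; rewrite prod_set_mnm.
Qed.

Lemma cover_ideal_pow_covered E s f :
  ideal_pow (cover_ideal E) s f <-> monomial_ideal (K := K) (covered E s) f.
Proof.
apply: gen_ideal_monomial; first exact: upper_covered.
  move=> _ [gs [<- [hg ->]]]; elim: gs hg => [|g gs IH] hg.
    by rewrite big_nil => m _; exists [::].
  rewrite big_cons => m /msuppM_le /allpairsP [[a b] /= [ga gb ->]].
  rewrite -add1n; apply: coveredD.
    by apply: (cover_ideal_covered E g).1 ga; apply: hg; rewrite mem_head.
  by apply: IH gb => h hh; apply: hg; rewrite inE hh orbT.
move=> m [Ws [sz [/allP cv le]]].
(* ['X_[M]] is the product of the [s] monomials of the covers in [Ws], and it divides ['X_[m]]. *)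
pose M := (\sum_(W <- Ws) set_mnm W)%MM.
have le' : (M <= m)%MM.
  apply/mnm_lepP => i; apply: leq_trans (le i); rewrite mnm_sumE -sum1_count [leqRHS]big_mkcond.
  by apply: leq_sum => W _; rewrite mnmE; case: (i \in W).
rewrite -(submK le') mpolyXD; apply: gen_ideal_mul.
exists [seq 'X_[set_mnm W] | W <- Ws]; split.
  by rewrite size_map.
split; last first.
  rewrite big_map; apply: (big_morph (fun m => 'X_[m])) => [a b|].
    exact: mpolyXD.
  exact: mpolyX0.
move=> _ /mapP [W /cv cW ->]; apply/cover_ideal_covered/monomial_idealX.
by exists [:: W]; rewrite /= cW; split=> //; split=> // i; rewrite mnmE addn0.
Qed.

End Covers.

(** * Covers after adding the edge *)

Section AddedEdge.
Variables (n t : nat) (v : 'I_n) (E : {set {set 'I_n}}).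

Definition restrict_mnm (m : 'X_{1..n + t}) : 'X_{1..n} := [multinom m (lshift t i) | i < n].

(** ['X_[m]] lies in the [s]-th power of the prime generated by the variables of the added edge
    exactly when this degree is at least [s]. *)
Definition added_deg (m : 'X_{1..n + t}) : nat := \sum_(x in added_edge t v) m x.

Definition extend_mnm (m : 'X_{1..n}) : 'X_{1..n + t} :=
  [multinom (if split i is inl j then m j else 0%N) | i < n + t].

Lemma extend_mnm_lshift m i : extend_mnm m (lshift t i) = m i.
Proof. by rewrite mnmE -[lshift _ _]/(unsplit (inl _)) unsplitK. Qed.

Lemma extend_mnm_rshift m i : extend_mnm m (rshift n i) = 0%N.
Proof. by rewrite mnmE -[rshift _ _]/(unsplit (inr _)) unsplitK. Qed.

Lemma restrict_mnmD a b : restrict_mnm (a + b)%MM = (restrict_mnm a + restrict_mnm b)%MM.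
Proof. by apply/mnmP => i; rewrite !mnmE. Qed.

Lemma restrict_mnm0 : restrict_mnm 0%MM = 0%MM.
Proof. by apply/mnmP => i; rewrite !mnmE. Qed.

Lemma extend_mnmK : cancel extend_mnm restrict_mnm.
Proof. by move=> m; apply/mnmP => i; rewrite mnmE extend_mnm_lshift. Qed.

Lemma extend_mnmD a b : extend_mnm (a + b)%MM = (extend_mnm a + extend_mnm b)%MM.
Proof.
apply/mnmP => i; rewrite -[i]splitK mnmDE; case: (split i) => j /=.
  by rewrite !extend_mnm_lshift mnmDE.
by rewrite !extend_mnm_rshift.
Qed.

Lemma restrict_mnm_rshift i : restrict_mnm U_(rshift n i)%MM = 0%MM.
Proof. by apply/mnmP => j; rewrite !mnmE eq_rlshift. Qed.

Lemma extend_restrict_le m : (extend_mnm (restrict_mnm m) <= m)%MM.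
Proof.
apply/mnm_lepP => i; rewrite -[i]splitK; case: (split i) => j /=.
  by rewrite extend_mnm_lshift mnmE.
by rewrite extend_mnm_rshift.
Qed.

Lemma added_degD a b : added_deg (a + b)%MM = (added_deg a + added_deg b)%N.
Proof. by rewrite /added_deg -big_split; apply: eq_bigr => i _; rewrite mnmDE. Qed.

Lemma added_deg0 : added_deg 0%MM = 0%N.
Proof. by apply: big1 => i _; rewrite mnmE. Qed.

Lemma added_deg1 x : x \in added_edge t v -> added_deg U_(x)%MM = 1%N.
Proof.
move=> xe; rewrite /added_deg (bigD1 x) //= mnm1E eqxx big1 // => y /andP [_ yx].
by rewrite mnm1E eq_sym (negbTE yx).
Qed.

Lemma added_deg_gt0 m : (0 < added_deg m)%N -> exists2 x, x \in added_edge t v & (0 < m x)%N.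
Proof. by rewrite lt0n sum_nat_eq0 => /forall_inPn [x xe]; rewrite -lt0n; exists x. Qed.

Lemma added_degE : added_deg =1 fun m => (m (lshift t v) + \sum_i m (rshift n i))%N.
Proof.
move=> m; rewrite /added_deg big_setU1 /=; last first.
  by apply/imsetP => -[i _ /eqP]; rewrite eq_lrshift.
by rewrite big_imset //= => i j _ _; apply: rshift_inj.
Qed.

Lemma rshift_added i : rshift n i \in added_edge t v.
Proof. by rewrite !inE imset_f ?orbT. Qed.

Lemma lshift_added i : (lshift t i \in added_edge t v) = (i == v).
Proof.
rewrite !inE (inj_eq (@lshift_inj _ _)) orbC; case: imsetP => // -[j _ /eqP].
by rewrite eq_lrshift.
Qed.

Let EH := extend_edges t E :|: [set added_edge t v].

Lemma cover_extendP (W : {set 'I_(n + t)}) :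
  reflect (vertex_cover E (lshift t @^-1: W) /\ exists2 x, x \in W & x \in added_edge t v)
          (vertex_cover EH W).
Proof.
apply: (iffP (vertex_coverP _ _)) => [h|[/vertex_coverP hE ha] e].
  split; last by apply: h; rewrite !inE eqxx orbT.
  apply/vertex_coverP => e eE.
  have [|x xW /imsetP [y ye xy]] := h [set lshift t x | x in e].
    by rewrite inE imset_f.
  by exists y => //; rewrite inE -xy.
rewrite inE => /orP [/imsetP [e' /hE [x xW xe] ->]|]; last by rewrite inE => /eqP ->.
by exists (lshift t x); [rewrite inE in xW | apply: imset_f].
Qed.

(** Each cover of the enlarged hypergraph traces a cover of [E] on the old vertices and contains a
    vertex of the added edge, which contributes at least one to the added degree. *)
Lemma covered_extend_restrict s m :
  covered EH s m -> covered E s (restrict_mnm m) /\ (s <= added_deg m)%N.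
Proof.
move=> [Ws [<- [cv le]]]; split.
  exists [seq lshift t @^-1: W | W : {set 'I_(n + t)} <- Ws]; split; first by rewrite size_map.
  split; first by rewrite all_map; apply: sub_all cv => W /cover_extendP [].
  move=> i; rewrite count_map mnmE; apply: leq_trans (le _).
  by apply/eq_leq/eq_count => W /=; rewrite inE.
apply: leq_trans (leq_sum _ (fun i _ => le i)).
elim: Ws cv {le} => [//|W Ws IH] /= /andP [/cover_extendP [_ [x xW xe]] /IH h].
rewrite big_split /= -add1n leq_add // (bigD1 x) //= xW; exact: leq_addr.
Qed.

(** Induction on the list of covers: the first is completed by a vertex [x] of the added edge so
    that it uses exactly one unit of the added degree, which leaves enough for the others. *)
Lemma covered_extend s m :
  covered E s (restrict_mnm m) -> (s <= added_deg m)%N -> covered EH s m.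
Proof.
case=> Ws [<- [cv]]; elim: Ws m cv => [|W Ws IH] m; first by exists [::].
move=> /andP [cW cv] le sz.
pose LW := lshift t @: W.
have inLW i : (lshift t i \in LW) = (i \in W) by rewrite mem_imset //; apply: lshift_inj.
have notLW i : (rshift n i \in LW) = false.
  by apply/imsetP => -[j _ /eqP]; rewrite eq_rlshift.
suff [x [xe cond]] : exists x, x \in added_edge t v /\
    ((set_mnm (x |: LW) <= m)%MM /\
     (forall i, (count (fun W : {set 'I_n} => i \in W) Ws <=
                 restrict_mnm (m - set_mnm (x |: LW)) i)%N) /\
     added_deg (set_mnm (x |: LW)) = 1%N).
  case: cond => lem [le' d1]; rewrite -(submK lem) addmC; apply: covered_cons.
    apply/cover_extendP; split; last by exists x; rewrite ?setU11.
    apply/vertex_coverP => e /(vertex_coverP _ _ cW) [y yW ye].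
    by exists y; rewrite // !inE inLW yW orbT.
  apply: IH => //.
  have := added_degD (m - set_mnm (x |: LW)) (set_mnm (x |: LW)).
  by rewrite submK // d1 addn1 => e; rewrite e in sz.
(* The second hypothesis forces [x] to be [v] when the cover contains [v]: another vertex of the
   added edge would use up a second unit. *)
have degLW (x : 'I_(n + t)) : x \in added_edge t v ->
    (lshift t v \in x |: LW -> x = lshift t v) ->
    added_deg (set_mnm (x |: LW)) = 1%N.
  move=> xe hv; rewrite /added_deg (bigD1 x) //= mnmE setU11 big1 // => y /andP [ye yx].
  rewrite mnmE; have [yin|//] := boolP (y \in _); exfalso.
  have := yin; rewrite !inE (negbTE yx) /= => /imsetP [z zW yz].
  have zv : z = v by apply/eqP; rewrite -lshift_added -yz.
  by move: yin yx; rewrite yz zv => /hv ->; rewrite eqxx.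
(* Domination is checked separately on old vertices, where the remaining covers need room too, and
   on new ones, where they need none. *)
have step (x : 'I_(n + t)) :
    (forall i, (lshift t i \in x |: LW) + count (fun W : {set 'I_n} => i \in W) Ws
       <= m (lshift t i))%N ->
    (forall i, (rshift n i \in x |: LW) <= m (rshift n i))%N ->
    (set_mnm (x |: LW) <= m)%MM /\
     (forall i, (count (fun W : {set 'I_n} => i \in W) Ws <=
                 restrict_mnm (m - set_mnm (x |: LW)) i)%N).
  move=> hl hr; split.
    apply/mnm_lepP => i; rewrite -[i]splitK mnmE; case: (split i) => j /=; last exact: hr.
    by apply: leq_trans (hl j); apply: leq_addr.
  by move=> i; rewrite !mnmE leq_subRL ?hl //; apply: leq_trans (hl i); apply: leq_addr.
have le0 i : ((i \in W) + count (fun W : {set 'I_n} => i \in W) Ws <= m (lshift t i))%N.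
  by have := le i; rewrite mnmE.
(* A cover containing [v] is left as it is; the others receive a free variable [w_i] if one is
   left, and otherwise [v], whose exponent then exceeds the number of remaining covers. *)
have [vW|vW] := boolP (v \in W).
  exists (lshift t v); split; first by rewrite lshift_added.
  have eqLW : lshift t v |: LW = LW by apply/setUidPr; rewrite sub1set inLW.
  have [||-> h] := step (lshift t v); try (move=> i; rewrite eqLW).
  - by rewrite inLW; apply: le0.
  - by rewrite notLW.
  by split=> //; split=> //; apply: degLW; rewrite ?lshift_added.
have [/existsP [w mw]|/existsPn mw] := boolP [exists w, 0 < m (rshift n w)]%N.
  exists (rshift n w); split; first exact: rshift_added.
  have [||-> h] := step (rshift n w).
  - by move=> i; rewrite !inE eq_lrshift inLW; apply: le0.
  - move=> i; rewrite !inE notLW orbF (inj_eq (@rshift_inj _ _)).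
    by case: eqP => // ->; apply: mw.
  split=> //; split=> //; apply: degLW; first exact: rshift_added.
  by rewrite !inE eq_lrshift inLW (negbTE vW).
exists (lshift t v); split; first by rewrite lshift_added.
have [||-> h] := step (lshift t v).
- move=> i; rewrite !inE inLW (inj_eq (@lshift_inj _ _)); case: eqP => [->|_]; last exact: le0.
  move: sz; rewrite added_degE big1 ?addn0; last first.
    by move=> w _; apply/eqP; rewrite -leqn0 leqNgt.
  by apply: leq_trans; rewrite /= add1n ltnS count_size.
- by move=> i; rewrite !inE eq_rlshift notLW.
by split=> //; split=> //; apply: degLW; rewrite ?lshift_added.
Qed.

End AddedEdge.

(** * Prime upper sets: invariance and radicality *)

Section PrimeUpper.
Variable n : nat.
Implicit Types V : 'X_{1..n} -> Prop.

Lemma prime_upper_ext V V' : (forall u, V u <-> V' u) -> prime_upper V -> prime_upper V'.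
Proof.
move=> h [up [V0 pr]]; split; first by move=> a b /h Va; apply/h/up.
split; first by move/h.
by move=> a b /h /pr [] /h; [left|right].
Qed.

Lemma prime_upper_mulmn V a k : prime_upper V -> V (a *+ k)%MM -> V a.
Proof.
case=> _ [V0 pr]; elim: k => [|k IH]; first by rewrite mulm0n.
by rewrite mulmS => /pr [].
Qed.

Lemma monomial_ideal_ext (K : fieldType) V V' : (forall u, V u <-> V' u) ->
  forall f, monomial_ideal (K := K) V f <-> monomial_ideal V' f.
Proof. by move=> h f; split=> hf u /hf /h. Qed.

End PrimeUpper.

(** * Extension of monomial ideals to the larger ring *)

Section Extension.
Variables (K : fieldType) (n t : nat).

Lemma embed_polyX m : embed_poly t 'X_[m] = 'X_[extend_mnm t m] :> {mpoly K[n + t]}.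
Proof.
rewrite /embed_poly comp_mpolyX mpolyXE_id big_split_ord /= [X in _ = _ * X]big1 ?mulr1.
  by apply: eq_bigr => i _; rewrite tnth_mktuple extend_mnm_lshift.
by move=> i _; rewrite extend_mnm_rshift.
Qed.

Lemma upper_restrict V : upper V -> upper (fun u => V (@restrict_mnm n t u)).
Proof. by move=> up a b Va; rewrite restrict_mnmD; apply: up. Qed.

(** [extend_mnm] is an additive section of [restrict_mnm], so primality passes both ways. *)
Lemma prime_upper_restrict V :
  prime_upper V <-> prime_upper (fun u => V (@restrict_mnm n t u)).
Proof.
split=> -[up [V0 pr]].
  split; first exact: upper_restrict.
  split; first by rewrite restrict_mnm0.
  by move=> a b; rewrite restrict_mnmD; apply: pr.
split=> [a b Va|].
  by have := up (extend_mnm t a) (extend_mnm t b); rewrite -extend_mnmD !extend_mnmK; apply.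
split; first by rewrite restrict_mnm0 in V0.
by move=> a b; have := pr (extend_mnm t a) (extend_mnm t b); rewrite -extend_mnmD !extend_mnmK.
Qed.

(** Every exponent dominates the extension of its restriction, so extending the ideal amounts to
    ignoring the exponents of the new variables. *)
Lemma extend_monomial_ideal V (Q : {mpoly K[n]} -> Prop) : upper V ->
  (forall g, Q g <-> monomial_ideal V g) ->
  forall f, extend_ideal (t := t) Q f <-> monomial_ideal (fun u => V (restrict_mnm u)) f.
Proof.
move=> up hQ; have upR := upper_restrict up; apply: gen_ideal_monomial => //.
  move=> _ [g [/hQ hg ->]]; rewrite [g in embed_poly _ g]mpolyE /embed_poly raddf_sum.
  have idV := monomial_ideal_ideal K upR.
  apply: (is_ideal_sum idV) => u ug; rewrite /= comp_mpolyZ -/(embed_poly t _) embed_polyX.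
  apply: (ideal_term _ idV); apply/monomial_idealX.
  by rewrite extend_mnmK; apply: hg.
move=> u Vu; rewrite -(submK (extend_restrict_le u)) mpolyXD.
apply: gen_ideal_mul; exists 'X_[restrict_mnm u]; rewrite embed_polyX.
by split=> //; apply/hQ/monomial_idealX.
Qed.

Lemma added_edge_ideal (v : 'I_n) (f : {mpoly K[n + t]}) :
  gen_ideal (fun g => exists x, x \in added_edge t v /\ g = 'X_x) f <->
  monomial_ideal (fun u => 0 < added_deg v u)%N f.
Proof.
apply: gen_ideal_monomial.
- by move=> a b; rewrite added_degD addn_gt0 => ->.
- by move=> _ [x [xe ->]]; apply/monomial_idealX; rewrite added_deg1.
move=> u /added_deg_gt0 [x xe ux].
have le : (U_(x) <= u)%MM.
  by apply/mnm_lepP => i; rewrite mnm1E; case: eqP => // <-.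
by rewrite -(submK le) mpolyXD; apply: gen_ideal_mul; exists x.
Qed.

End Extension.

(** * The two kinds of associated primes *)

Lemma prime_upper_added_deg n t (v : 'I_n) :
  prime_upper (fun u : 'X_{1..n + t} => 0 < added_deg v u)%N.
Proof.
split; first by move=> a b; rewrite added_degD addn_gt0 => ->.
split; first by rewrite added_deg0.
by move=> a b; rewrite added_degD addn_gt0 => /orP.
Qed.

Lemma added_degMn n t (v : 'I_n) (a : 'X_{1..n + t}) k :
  added_deg v (a *+ k)%MM = (added_deg v a * k)%N.
Proof.
elim: k => [|k IH]; first by rewrite mulm0n added_deg0 muln0.
by rewrite mulmS added_degD IH mulnS.
Qed.

Lemma restrict_mnm_rshiftMn n t (i : 'I_t) k :
  @restrict_mnm n t (U_(rshift n i) *+ k)%MM = 0%MM.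
Proof.
elim: k => [|k IH]; first by rewrite mulm0n restrict_mnm0.
by rewrite mulmS restrict_mnmD IH restrict_mnm_rshift addm0.
Qed.

(** The complement of [v] meets every edge; taking it [s] times gives a monomial of the [s]-th power
    free of the variable of [v]. *)
Lemma covered_setC1 n (v : 'I_n) (E : {set {set 'I_n}}) s :
  (forall e, e \in E -> ~~ (e \subset [set v])) ->
  covered E s [multinom (if i == v then 0 else s)%N | i < n].
Proof.
move=> hE; exists (nseq s [set~ v]); rewrite size_nseq; split=> //; split.
  rewrite all_nseq; apply/orP; right; apply/vertex_coverP => e /hE /subsetPn [x xe].
  by rewrite inE => xv; exists x; rewrite ?inE.
by move=> i; rewrite mnmE count_nseq !inE; case: eqP => // _; rewrite mul1n.
Qed.

Theorem theorem2p16 (K : fieldType) (n t : nat) (v : 'I_n)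
  (EG : {set {set 'I_n}}) (EH : {set {set 'I_(n + t)}}) :
  (0 < t)%N ->
  simple_hypergraph EG ->
  simple_hypergraph EH ->
  EH = extend_edges t EG :|: [set added_edge t v] ->
  forall s : nat, (1 <= s)%N ->
  forall P : {mpoly K[n + t]} -> Prop,
    Ass (ideal_pow (cover_ideal (K:=K) EH) s) P <->
    ((exists Q : {mpoly K[n]} -> Prop,
         Ass (ideal_pow (cover_ideal (K:=K) EG) s) Q /\
         (forall f, P f <-> extend_ideal (t:=t) Q f))
     \/ (forall f, P f <-> gen_ideal (fun g => exists x, x \in added_edge t v /\ g = 'X_x) f)).
Proof.
move=> t_gt0 _ simH EHE s s_gt0 P.
have AssE N E (I : {mpoly K[N]} -> Prop) : Ass (ideal_pow (cover_ideal E) s) I <->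
    exists m, prime_upper (fun u => covered E s (u + m)%MM) /\
            forall g, I g <-> monomial_ideal (fun u => covered E s (u + m)%MM) g.
  rewrite -(Ass_monomial_ideal _ (@upper_covered _ E s)).
  exact: Ass_ext (cover_ideal_pow_covered E s).
have covH m : covered EH s m <-> covered EG s (restrict_mnm m) /\ (s <= added_deg v m)%N.
  by rewrite EHE; split=> [/covered_extend_restrict|[]]; last exact: covered_extend.
have upE (m : 'X_{1..n}) : upper (fun u => covered EG s (u + m)%MM).
  by move=> a b h; rewrite -addmA [(b + m)%MM]addmC addmA; apply: upper_covered.
(* Powers of this new variable raise the added degree without changing the restriction. *)
pose w : 'I_t := Ordinal t_gt0.
have dw k : added_deg v (U_(rshift n w) *+ k)%MM = k.
  by rewrite added_degMn added_deg1 ?rshift_added ?mul1n.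
rewrite AssE; split.
  case=> m [prm hP].
  have [Um|nUm] := classic (covered EG s (restrict_mnm m)).
    right=> f; rewrite hP added_edge_ideal; apply: monomial_ideal_ext => u.
    (* Otherwise [m] itself would be covered, and the prime upper set would contain 0. *)
    have dm : (added_deg v m < s)%N.
      case: (prm) => _ [V0 _]; rewrite ltnNge; apply/negP => le; apply: V0.
      by rewrite add0m; apply/covH.
    rewrite covH restrict_mnmD added_degD; split=> [[_ le]|/added_deg_gt0 [x xe ux]].
      by rewrite lt0n; apply/eqP => d0; rewrite d0 add0n leqNgt dm in le.
    have le : (U_(x) <= u)%MM.
      by apply/mnm_lepP => i; rewrite mnm1E; case: eqP => // <-.
    (* The [s]-th power of [x] brings the added degree to at least [s], and a prime containing a
       power of [x] contains [x]. *)
    have Vx : covered EH s (U_(x) + m)%MM.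
      apply: (prime_upper_mulmn (k := s) prm); apply/covH.
      rewrite restrict_mnmD addmC added_degD added_degMn added_deg1 // mul1n leq_addr.
      by split=> //; apply: upper_covered.
    by rewrite -restrict_mnmD -added_degD -covH -(submK le) [(_ - _ + _)%MM]addmC; apply: prm.1.
  left; exists (monomial_ideal (fun u => covered EG s (u + restrict_mnm m)%MM)).
  have VE u : covered EH s (u + m)%MM <-> covered EG s (restrict_mnm u + restrict_mnm m)%MM.
    split=> [/covH []|Vu]; first by rewrite restrict_mnmD.
    (* The [s]-th power of [w] times ['X_[u]] lies in the prime, while that power alone does not, by
       [nUm]; hence [u] does. *)
    case: (prm) => _ [_ /(_ (U_(rshift n w) *+ s)%MM u)] [||//].
      apply/covH; rewrite !restrict_mnmD restrict_mnm_rshiftMn add0m.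
      by rewrite !added_degD dw -addnA leq_addr.
    by move/covH; rewrite restrict_mnmD restrict_mnm_rshiftMn add0m => -[].
  split.
    apply/AssE; exists (restrict_mnm m); split=> //.
    by apply/(prime_upper_restrict t); apply: prime_upper_ext prm.
  move=> f; rewrite hP (extend_monomial_ideal (upE (restrict_mnm m))) //.
  exact: monomial_ideal_ext.
case=> [[Q [/AssE [m [prm hQ]] hP]]|hP].
  (* The factor in [w] gives added degree at least [s] for every [u], so only the condition on
     covers of [EG] remains. *)
  pose m' := (extend_mnm t m + U_(rshift n w) *+ s)%MM.
  have VE u : covered EG s (restrict_mnm u + m)%MM <-> covered EH s (u + m')%MM.
    rewrite covH !restrict_mnmD !added_degD dw extend_mnmK restrict_mnm_rshiftMn addm0.
    by rewrite addnA leq_addl; split=> // -[].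
  exists m'; split.
    exact: (prime_upper_ext VE ((prime_upper_restrict t _).1 prm)).
  by move=> f; rewrite hP (extend_monomial_ideal (upE m)) //; apply: monomial_ideal_ext.
(* [m0] is covered in [EG] and has added degree 0. The power [s.-1] of [w] leaves the added degree
   one short of [s], so any variable of the added edge completes it. *)
pose m0 : 'X_{1..n} := [multinom (if i == v then 0 else s)%N | i < n].
pose m' := (extend_mnm t m0 + U_(rshift n w) *+ s.-1)%MM.
have Um0 : covered EG s m0.
  apply: covered_setC1 => e eE; apply/negP => ev.
  (* An edge inside [[set v]] would embed into the added edge; simplicity of [EH] makes the two
     equal, although the added edge contains a new vertex. *)
  have eq : [set lshift t x | x in e] = added_edge t v.
    apply: simH; rewrite ?EHE ?inE ?eqxx ?orbT ?imset_f //.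
    apply/subsetP => _ /imsetP [x /(subsetP ev) + ->].
    by rewrite inE lshift_added.
  have := rshift_added v w; rewrite -eq => /imsetP [x _ /eqP].
  by rewrite eq_rlshift.
have d0 : added_deg v (extend_mnm t m0) = 0%N.
  rewrite added_degE extend_mnm_lshift mnmE eqxx big1 // => i _.
  by rewrite extend_mnm_rshift.
have VE u : (0 < added_deg v u)%N <-> covered EH s (u + m')%MM.
  rewrite covH !restrict_mnmD !added_degD dw d0 extend_mnmK restrict_mnm_rshiftMn addm0 add0n.
  have -> : (s <= added_deg v u + s.-1)%N = (0 < added_deg v u)%N.
    by rewrite -{1}(prednK s_gt0) -add1n leq_add2r.
  rewrite addmC; split=> [h|[]//].
  by split=> //; apply: upper_covered.
exists m'; split; first by apply: prime_upper_ext VE _; apply: prime_upper_added_deg.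
by move=> f; rewrite hP added_edge_ideal; apply: monomial_ideal_ext.
Qed.
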